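(* Let $(V,\omega)$ be a real symplectic vector space of dimension $2n$, $n\ge 2$, let $L\in\mathcal{L}(V)$ and $\rho\in T_L^*\mathcal{L}(V)$. Then $g_\rho$ is decomposable if and only if the set of $(n-1)$-dimensional characteristic subspaces for $\rho$ is the union of two (possibly coinciding) $(n-2)$-parametric families $\mathcal{H}$ and $\mathcal{H}'$ of hyperplanes of $L$ such that $$\dim\bigcap_{U\in\mathcal{H}}U=\dim\bigcap_{U\in\mathcal{H}'}U=1 .$$
   Context: $\mathcal{L}(V)$ is the smooth manifold of Lagrangian planes of $(V,\omega)$ ($n$-dimensional subspaces on which $\omega$ vanishes). For $\dot L\in T_L\mathcal{L}(V)$ let $\phi_t$ be any one-parameter subgroup of $Sp(V)$ with $\frac{d}{dt}\big|_{t=0}\phi_t(L)=\dot L$ and put $g^{\dot L}(v,w)=\omega\big(\frac{d}{dt}\big|_{t=0}\phi_t(v),w\big)$ for $v,w\in L$; $\dot L\mapsto g^{\dot L}$ is a well-defined linear isomorphism $T_L\mathcal{L}(V)\to S^2(L^* )$. A covector $\rho\in T_L^*\mathcal{L}(V)$ defines $g_\rho\in S^2(L)$, a symmetric bilinear form on $L^*$: $g_\rho(\alpha,\beta)=\rho(\dot L)$ where $g^{\dot L}=\alpha\vee\beta:=\tfrac12(\alpha\otimes\beta+\beta\otimes\alpha)$. ''Decomposable'' means $g_\rho=v\vee w$ for some nonzero $v,w\in L$ (possibly proportional). For an isotropic subspace $U\subset V$, $U^{(1)}=\{L'\in\mathcal{L}(V)\mid L'\supseteq U\}$. An isotropic $U$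 is characteristic for $\rho\in T_L^*\mathcal{L}(V)$ if $U\subset L$ and $\rho|_{T_LU^{(1)}}=0$. An $(n-2)$-parametric family of hyperplanes of $L$ is an $(n-2)$-dimensional submanifold of the space $Gr_{n-1}(L)\simeq\mathbb{P}L^*$ of hyperplanes of $L$. *)

(* Defs.v *)
From HB Require Import structures.
From mathcomp Require Import all_boot all_order all_algebra sesquilinear.
From mathcomp Require Import all_classical all_reals all_analysis.
Set Implicit Arguments.
Unset Strict Implicit.
Unset Printing Implicit Defensive.
Import Order.TTheory GRing.Theory Num.Theory.
Import numFieldNormedType.Exports.
Local Open Scope classical_set_scope.
Local Open Scope ring_scope.

Section Smooth.
Context {R : realType}.

(* C^k on A, meant for open A: f is differentiable and all its directional
   derivatives are C^(k-1). *)
Fixpoint Ck_on (E F : normedModType R) (k : nat) (A : set E) (f : E -> F) : Prop :=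
  if k is k'.+1 then
    (forall x, A x -> differentiable f x) /\
    (forall v : E, Ck_on k' A ('D_v f))
  else forall x, A x -> {for x, continuous f}.

Definition smooth_on (E F : normedModType R) (A : set E) (f : E -> F) : Prop :=
  forall k, Ck_on k A f.

Definition diffeomorphism (m : nat) (A B : set 'rV[R]_m)
    (f g : 'rV[R]_m -> 'rV[R]_m) : Prop :=
  [/\ open A, open B, smooth_on A f, smooth_on B g &
   [/\ (forall x, A x -> B (f x)), (forall y, B y -> A (g y)),
       (forall x, A x -> g (f x) = x) & (forall y, B y -> f (g y) = y)]].

(* Embedded k-dimensional submanifold of R^m, by slice charts. *)
Definition submanifold (m k : nat) (S : set 'rV[R]_m) : Prop :=
  forall p, S p -> exists A B f g,
    [/\ A p, diffeomorphism A B f g &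
     forall x, A x -> (S x <-> forall i : 'I_m, (k <= i)%N -> f x 0 i = 0)].

End Smooth.

Section LagrangianGrassmannian.
Context {R : realType} {V : vectType R}.

(* A vectType carries no topology; smoothness and derivatives of a curve in V
   are tested on all linear functionals, equivalently on coordinates. *)
Definition smooth_curve (c : R -> V) : Prop :=
  forall f : 'Hom(V, R^o), smooth_on setT (fun t : R => f (c t) : R^o).

Definition vderive (c : R -> V) (t : R) (u : V) : Prop :=
  forall f : 'Hom(V, R^o), is_derive t (1 : R) (fun s : R => f (c s) : R^o) (f u).

(* A curve of subspaces is smooth when it is locally spanned by a smooth frame. *)
Definition smooth_vscurve (gamma : R -> {vspace V}) : Prop :=
  forall t0 : R, exists e : 'I_(\dim (gamma t0)) -> R -> V,
    (forall i, smooth_curve (e i)) /\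
    (\forall t \near t0, basis_of (gamma t) [seq e i t | i <- enum 'I_(\dim (gamma t0))]).

(* V/L is modelled on a complement of L: quot_map is onto, with kernel L. *)
Definition quot (L : {vspace V}) : vectType R := subvs_of (L^C)%VS.

Definition quot_map (L : {vspace V}) : 'Hom(V, quot L) :=
  (linfun (vsproj (L^C)%VS) \o daddv_pi (L^C)%VS L)%VF.

Lemma lker_quot_map (L : {vspace V}) : lker (quot_map L) = L.
Proof.
have dx : (L^C :&: L = 0)%VS by rewrite capvC capv_compl.
have dx' : (L :&: L^C = 0)%VS by rewrite capv_compl.
apply/vspaceP => v; rewrite memv_ker /quot_map comp_lfunE lfunE /=.
have vE : v = daddv_pi L^C L v + daddv_pi L L^C v.
  by rewrite daddv_pi_add // addvC addv_complf memvf.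
apply/eqP/idP => [h|vL].
  rewrite vE; have /(congr1 vsval) := h.
  by rewrite vsprojK ?memv_pi // linear0 => ->; rewrite add0r memv_pi.
rewrite [X in vsproj _ X](_ : _ = 0) ?linear0 //.
have -> : daddv_pi L^C L v = v - daddv_pi L L^C v by rewrite {2}vE addrK.
by rewrite (daddv_pi_id dx') // subrr.
Qed.

Lemma limg_quot_map (L : {vspace V}) : limg (quot_map L) = fullv.
Proof.
have dx : (L^C :&: L = 0)%VS by rewrite capvC capv_compl.
apply/vspaceP => v; rewrite memvf; apply/memv_imgP.
exists (vsval v); first exact: memvf.
by rewrite /quot_map comp_lfunE lfunE /= (daddv_pi_id dx) ?subvsP // vsvalK.
Qed.

(* T_L Gr(V) = Hom(L, V/L). *)
Definition grass_tangent (L : {vspace V}) : vectType R := 'Hom(subvs_of L, quot L).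

Definition velocity (L : {vspace V}) (gamma : R -> {vspace V})
    (Ldot : grass_tangent L) : Prop :=
  [/\ smooth_vscurve gamma, gamma 0 = L &
   forall (c : R -> V) (u : V), smooth_curve c ->
     (\forall t \near (0 : R), c t \in gamma t) -> vderive c 0 u ->
     (Ldot : 'Hom(_, _)) (vsproj L (c 0)) = quot_map L u].

(* Velocities at L of the smooth curves of subspaces contained in M. *)
Definition tangent_to (M : set {vspace V}) (L : {vspace V})
    (Ldot : grass_tangent L) : Prop :=
  exists2 gamma, (forall t, M (gamma t)) & velocity gamma Ldot.

Variable omega : {skew_symmetric V}.

Definition isotropic (U : {vspace V}) : Prop :=
  forall u v, u \in U -> v \in U -> omega u v = 0.

Definition lagrangian : set {vspace V} :=
  [set L | isotropic L /\ (2 * \dim L = \dim {:V})%N].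

(* U^(1) *)
Definition lagr_containing (U : {vspace V}) : set {vspace V} :=
  [set L' | lagrangian L' /\ (U <= L')%VS].

Definition lagr_tangent (L : {vspace V}) : set (grass_tangent L) :=
  tangent_to lagrangian (L := L).

(* Elements of the dual of T_L L(V): only the values of rho on T_L L(V)
   are ever used. *)
Definition lagr_covector (L : {vspace V}) (rho : grass_tangent L -> R) : Prop :=
  forall (a : R) (X Y : grass_tangent L), lagr_tangent X -> lagr_tangent Y ->
    rho (a *: X + Y) = a * rho X + rho Y.

Definition one_parameter_subgroup (phi : R -> 'End(V)) : Prop :=
  [/\ phi 0 = \1%VF, (forall s t, phi (s + t) = (phi s \o phi t)%VF),
      (forall t v w, omega (phi t v) (phi t w) = omega v w) &
      (forall v, smooth_curve (fun t => phi t v))].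

(* g is the bilinear form g^Ldot on L. *)
Definition tangent_form (L : {vspace V}) (Ldot : grass_tangent L)
    (g : subvs_of L -> subvs_of L -> R) : Prop :=
  exists phi : R -> 'End(V), exists dphi : V -> V,
  [/\ one_parameter_subgroup phi,
      velocity (fun t => (phi t @: L)%VS) Ldot,
      (forall v, vderive (fun t => phi t v) 0 (dphi v)) &
      forall v w, g v w = omega (dphi (vsval v)) (vsval w)].

Definition covector_symprod (E : vectType R) (alpha beta : 'Hom(E, R^o)) (v w : E) : R :=
  2^-1 * (alpha v * beta w + beta v * alpha w).

Definition vector_symprod (E : vectType R) (v w : E) (alpha beta : 'Hom(E, R^o)) : R :=
  2^-1 * (alpha v * beta w + alpha w * beta v).

(* g_rho (alpha, beta) = rho (Ldot) for the Ldot with g^Ldot = alpha \/ beta *)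
Definition covector_form (L : {vspace V}) (rho : grass_tangent L -> R)
    (alpha beta : 'Hom(subvs_of L, R^o)) : R :=
  rho (xget 0 [set Ldot : grass_tangent L |
    lagr_tangent Ldot /\ tangent_form Ldot (covector_symprod alpha beta)]).

Definition decomposable (L : {vspace V}) (rho : grass_tangent L -> R) : Prop :=
  exists v w : subvs_of L, [/\ v != 0, w != 0 &
    forall alpha beta, covector_form rho alpha beta = vector_symprod v w alpha beta].

Definition characteristic (L : {vspace V}) (rho : grass_tangent L -> R)
    (U : {vspace V}) : Prop :=
  [/\ isotropic U, (U <= L)%VS &
   forall Ldot : grass_tangent L,
     tangent_to (lagr_containing U) Ldot -> rho Ldot = 0].

End LagrangianGrassmannian.

Section HyperplaneFamilies.
Context {R : realType} {V : vectType R}.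

Definition hyperplanes (L : {vspace V}) : set {vspace V} :=
  [set U | (U <= L)%VS /\ (\dim U).+1 = \dim L].

(* For a basis X_0, ..., X_m of L, x |-> span (X_j - x_j X_0 : 1 <= j <= m)
   is the inverse of the affine chart of Gr_m(L) whose domain consists of the
   hyperplanes not containing X_0; in P(L^* ) it is the chart [alpha] |->
   (alpha(X_j) / alpha(X_0))_j. *)
Definition hyperplane_chart_inv (m : nat) (X : m.+1.-tuple V) (x : 'rV[R]_m) : {vspace V} :=
  <<[seq (tnth X (lift ord0 j) - x 0 j *: tnth X ord0)%R | j <- enum 'I_m]>>%VS.

(* k-dimensional submanifold of the Grassmannian of hyperplanes of L *)
Definition hyperplane_family (L : {vspace V}) (k : nat) (H : set {vspace V}) : Prop :=
  H `<=` hyperplanes L /\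
  forall X : (\dim L).-1.+1.-tuple V, basis_of L X ->
    submanifold k [set x | H (hyperplane_chart_inv X x)].

(* The intersection is taken inside L, so it is L for empty H. *)
Definition dim_bigcap (L : {vspace V}) (H : set {vspace V}) (d : nat) : Prop :=
  exists2 W : {vspace V},
    (forall v, v \in W <-> v \in L /\ forall U, H U -> v \in U) & \dim W = d.

End HyperplaneFamilies.

(* Main.v *)
Require Import Defs.
From HB Require Import structures.
From mathcomp Require Import all_boot all_order all_algebra sesquilinear.
From mathcomp Require Import perm ring.
From mathcomp Require Import all_classical all_reals all_analysis.
Set Implicit Arguments.
Unset Strict Implicit.
Unset Printing Implicit Defensive.
Import Order.TTheory GRing.Theory Num.Theory.
Import numFieldNormedType.Exports.
Local Open Scope classical_set_scope.
Local Open Scope ring_scope.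

(** Write q(a) = g_rho(a,a) for a in the dual of L. A hyperplane of L is the kernel
    of a nonzero covector a, and a tangent vector to the Lagrangian subspaces
    containing it has a form g^Ldot that vanishes on ker a in both arguments, so
    it is a multiple of the square of a. Hence ker a is characteristic exactly
    when q(a) = 0 [characteristic_kernel]: the characteristic hyperplanes form
    the projective quadric of g_rho, and the theorem says that a quadric is a
    pair of hyperplanes, in the dual, if and only if its equation splits.

    If g_rho is the symmetric product of v and w, then q(a) = a(v) a(w), so the
    quadric is the union of the pencils of hyperplanes of L through v and through
    w. In an affine chart of the space of hyperplanes such a pencil is an affine
    hyperplane or empty, so it is a submanifold of dimension n - 2
    [hyperplane_family_through], and the members of the pencil through v meet in
    the line of v [dim_bigcap_through].

    Conversely, let v and w span the two intersections. Then q(a) = 0 implies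
    a(v) a(w) = 0, and the covectors with kernel in H span the annihilator of v,
    as otherwise the intersection would be larger. These two facts force q to be
    a product of linear forms [quadric_in_hyperplanes], by an argument that is
    purely algebraic.

    The link with the differential geometry is that every symmetric product of
    covectors of L is realized by a tangent vector of an explicit curve: choosing
    representatives in V that are orthogonal to each other, one gets an element
    A of sp(V) with A^2 = 0, whose one-parameter group 1 + t A moves L
    [symprod_tangent]. Such curves suffice because a tangent vector is determined
    by its pairing with L [tangent_pairing_inj]. *)

(** * Covectors and hyperplanes of a finite dimensional space *)

Section DualSpaces.
Context {K : fieldType} {E : vectType K}.

(** Project onto a complement of W: the image of u is nonzero, hence so is one
    of its coordinates. *)
Lemma separating_functional (W : {vspace E}) (u : E) : u \notin W ->
  exists a : 'Hom(E, K^o), (forall w, w \in W -> a w = 0) /\ a u != 0.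
Proof.
move=> uW.
have dx : (W^C :&: W = 0)%VS by rewrite capvC capv_compl.
have dx' : (W :&: W^C = 0)%VS by rewrite capv_compl.
have add w : w = daddv_pi W^C W w + daddv_pi W W^C w.
  by rewrite daddv_pi_add // addvC addv_complf memvf.
have piW w : w \in W -> daddv_pi W^C W w = 0.
  by move=> wW; apply: (addIr (daddv_pi W W^C w)); rewrite -add add0r daddv_pi_id.
have piu : daddv_pi W^C W u != 0.
  apply: contra uW => /eqP p0; rewrite [u]add p0 add0r; exact: memv_pi.
have [i ci] : exists i, coord (vbasis {:E}) i (daddv_pi W^C W u) != 0.
  apply: contrapT => /forallNP h; case/negP: piu; apply/eqP.
  rewrite [LHS](coord_vbasis (memvf _)) big1 // => i _.
  by have /negP/negPn/eqP -> := h i; rewrite scale0r.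
exists (linfun (coord (vbasis {:E}) i : E -> K^o) \o daddv_pi W^C W)%VF.
by split=> [w /piW pw|]; rewrite comp_lfunE lfunE //= pw linear0.
Qed.

(** Reflexivity of a finite dimensional space. It turns linear conditions on
    covectors into conditions on vectors, which is how the intersection of a
    family of hyperplanes enters the algebra. *)
Lemma bidual_eval (F : 'Hom(E, K^o) -> K) :
    (forall k a b, F (k *: a + b) = k * F a + F b) ->
  exists x, forall a, F a = a x.
Proof.
move=> linF.
pose FM := GRing.isLinear.Build K 'Hom(E, K^o) K^o *:%R F linF.
pose Fl : {linear 'Hom(E, K^o) -> K^o} := HB.pack F FM.
pose e := vbasis {:E}; pose ec i := linfun (coord e i : E -> K^o).
exists (\sum_(i < \dim {:E}) F (ec i) *: e`_i) => a.
have aE : a = \sum_(i < \dim {:E}) a e`_i *: ec i.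
  apply/lfunP => v; rewrite sum_lfunE {1}[v](coord_vbasis (memvf v)) linear_sum.
  by apply: eq_bigr => i _; rewrite linearZ scale_lfunE lfunE /= /GRing.scale /= mulrC.
rewrite {1}aE -[F _]/(Fl _) !linear_sum.
by apply: eq_bigr => i _; rewrite !linearZ /= /GRing.scale /= mulrC.
Qed.

Lemma dim_dual : \dim {: 'Hom(E, K^o)} = \dim {: E}.
Proof. by rewrite !dimvf [LHS]/dim /= muln1. Qed.

Lemma functional_neq0 (v : E) : v != 0 -> exists a : 'Hom(E, K^o), a v != 0.
Proof.
rewrite -memv0 => /separating_functional[a [_ av]].
by exists a.
Qed.

End DualSpaces.

Section HyperplaneKernels.
Context {K : fieldType} {V : vectType K} (L : {vspace V}).
Implicit Types (a : 'Hom(subvs_of L, K^o)) (U : {vspace V}).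

(** The kernel of a covector of L, pushed forward to the ambient space V, where
    characteristic subspaces live. *)
Definition kernel_in a : {vspace V} := (linfun (@vsval _ _ L) @: lker a)%VS.

Lemma vsval_inP (x : V) : x \in L -> exists u : subvs_of L, x = vsval u.
Proof. by move=> xL; exists (vsproj L x); rewrite vsprojK. Qed.

Lemma mem_kernel_in a (u : subvs_of L) : (vsval u \in kernel_in a) = (a u == 0).
Proof.
rewrite -memv_ker; apply/memv_imgP/idP => [[w wa]|ua].
  by rewrite lfunE /= => /subvs_inj ->.
by exists u => //; rewrite lfunE.
Qed.

Lemma kernel_in_sub a : (kernel_in a <= L)%VS.
Proof. by apply/subvP => _ /memv_imgP[u _ ->]; rewrite lfunE subvsP. Qed.

Lemma dim_kernel_in a : a != 0 -> (\dim (kernel_in a)).+1 = \dim L.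
Proof.
move=> a0; rewrite limg_dim_eq; last first.
  apply/eqP; rewrite -subv0; apply/subvP => u; rewrite memv_cap !memv_ker lfunE /=.
  by rewrite memv0 => /andP[_ /eqP u0]; apply/eqP/subvs_inj; rewrite u0 linear0.
have dimE : \dim {: subvs_of L} = \dim L by rewrite dimvf.
rewrite -dimE -(limg_ker_dim a fullv) capfv.
suff -> : \dim (limg a) = 1%N by rewrite addn1.
have [u au] : exists u, a u != 0.
  by have /lfunPn[u] := a0; rewrite zero_lfunE; exists u.
apply/eqP; rewrite eqn_leq; apply/andP; split.
  by rewrite (leq_trans (dimvS (subvf _))) // dimvf.
by rewrite lt0n dimv_eq0; apply: contra au; rewrite -memv0 => /eqP <-; rewrite memv_img ?memvf.
Qed.

(** A functional that vanishes on U and not at some point of L restricts to a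
    covector of L whose kernel contains U and has the same dimension. *)
Lemma hyperplane_kernel U : (U <= L)%VS -> (\dim U).+1 = \dim L ->
  exists2 a, a != 0 & U = kernel_in a.
Proof.
move=> UL dU.
have /subvPn[z zL zU] : ~~ (L <= U)%VS.
  by apply: contraPN dU => /dimvS h e; move: h; rewrite -e ltnn.
have [b [bU bz]] := separating_functional zU.
pose a : 'Hom(subvs_of L, K^o) := (b \o linfun (@vsval _ _ L))%VF.
have aE u : a u = b (vsval u) by rewrite comp_lfunE lfunE.
have a0 : a != 0.
  by apply/lfunPn; exists (vsproj L z); rewrite aE vsprojK // zero_lfunE.
exists a => //; apply/eqP; rewrite eqEdim -ltnS dim_kernel_in // -dU leqnn andbT.
apply/subvP => x xU; have [u xE] := vsval_inP (subvP UL _ xU).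
by rewrite xE mem_kernel_in aE -xE bU.
Qed.

End HyperplaneKernels.

(** * Quadrics contained in the union of two hyperplanes *)

Section PolynomialOnLines.
Context {K : numFieldType} {E : lmodType K}.
Implicit Types f g : E -> K.

(** Polynomial functions are only used through their restrictions to lines:
    this is all that the integral domain property below needs, and it avoids a
    choice of coordinates on the dual space. *)
Definition poly_on_lines f := forall a b,
  exists p : {poly K}, forall t, f (a + t *: b) = p.[t].

Lemma poly_on_linesD f g :
  poly_on_lines f -> poly_on_lines g -> poly_on_lines (fun x => f x + g x).
Proof.
move=> pf pg a b; have [p pE] := pf a b; have [q qE] := pg a b.
by exists (p + q) => t; rewrite hornerD pE qE.
Qed.

Lemma poly_on_linesM f g :
  poly_on_lines f -> poly_on_lines g -> poly_on_lines (fun x => f x * g x).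
Proof.
move=> pf pg a b; have [p pE] := pf a b; have [q qE] := pg a b.
by exists (p * q) => t; rewrite hornerM pE qE.
Qed.

Lemma poly_on_lines_cst c : poly_on_lines (fun=> c).
Proof. by move=> a b; exists c%:P => t; rewrite hornerC. Qed.

Lemma poly_on_lines_linear f :
  (forall k a b, f (k *: a + b) = k * f a + f b) -> poly_on_lines f.
Proof.
move=> lf a b; exists (f b *: 'X + (f a)%:P) => t.
by rewrite !hornerE addrC lf mulrC.
Qed.

(** If f is nonzero at a and g at b, their restrictions to the line through a
    and b are nonzero polynomials; their product has finitely many roots, while
    the line has infinitely many points. *)
Lemma poly_on_lines_eq0 f g : poly_on_lines f -> poly_on_lines g ->
    (forall x, f x * g x = 0) ->
  (forall x, f x = 0) \/ (forall x, g x = 0).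
Proof.
move=> pf pg fg; have [|/existsNP[a fa]] := pselect (forall x, f x = 0).
  by left.
right => b; apply: contrapT => gb.
have [p pE] := pf a (b - a); have [q qE] := pg a (b - a).
(* the integers i = 0, ..., size (p * q) - 1 are too many roots *)
have pq : p * q = 0.
  apply: (@roots_geq_poly_eq0 _ _ [seq i%:R | i <- iota 0 (size (p * q))]).
  - by apply/allP => t _; rewrite /root hornerM -pE -qE fg.
  - rewrite map_inj_uniq ?iota_uniq //; exact: (mulrIn (oner_neq0 K)).
  - by rewrite size_map size_iota.
move/eqP: pq; rewrite mulf_eq0 => /orP[]/eqP p0.
  by apply: fa; have := pE 0; rewrite scale0r addr0 p0 horner0.
by apply: gb; have := qE 1; rewrite scale1r addrC subrK p0 horner0.
Qed.

End PolynomialOnLines.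

Section QuadricInHyperplanes.
Context {K : numFieldType} {E : vectType K}.
Local Notation dual := 'Hom(E, K^o).
Variable g : dual -> dual -> K.
Hypothesis g_sym : forall a b, g a b = g b a.
Hypothesis g_lin : forall c k a b, g (k *: a + b) c = k * g a c + g b c.

Let evalE (v : E) k (a b : dual) : (k *: a + b) v = k * a v + b v.
Proof. by rewrite add_lfunE scale_lfunE. Qed.

Let g_linr c k a b : g c (k *: a + b) = k * g c a + g c b.
Proof. by rewrite g_sym g_lin ![g _ c]g_sym. Qed.

Let poly_eval v : poly_on_lines (fun a : dual => a v : K).
Proof. by apply: poly_on_lines_linear => k a b; rewrite evalE. Qed.

Let poly_g a : poly_on_lines (g a).
Proof. by apply: poly_on_lines_linear => k b c; rewrite g_linr. Qed.

Let poly_q : poly_on_lines (fun b => g b b).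
Proof.
move=> a b; exists (g b b *: 'X^2 + (2 * g a b) *: 'X + (g a a)%:P) => t.
rewrite !hornerD !hornerZ hornerXn hornerX hornerC addrC.
by rewrite g_lin !g_linr [g b a]g_sym; ring.
Qed.

Let eval_neq0 v : v != 0 -> ~ (forall a : dual, a v = 0).
Proof. by move=> /functional_neq0[a av] h; rewrite h eqxx in av. Qed.

Lemma polarization (x y : E) : (forall b, g b b = b x * b y) ->
  forall a b, g a b = 2^-1 * (a x * b y + a y * b x).
Proof.
move=> q a b; have := q (1 *: a + b).
rewrite g_lin !g_linr !evalE !q [g b a]g_sym => h.
have h2 : 2 * g a b = a x * b y + a y * b x.
  apply: (addrI (a x * a y + b x * b y)).
  transitivity ((1 * a x + b x) * (1 * a y + b y)); last by ring.
  by rewrite -h; ring.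
by rewrite -h2 mulrA mulVf ?mul1r // pnatr_eq0.
Qed.

(** The algebraic core. For a zero a of the quadratic form q and any b, the
    vector c = q(b) a - 2 g(a,b) b is again a zero: it is the second intersection
    of the quadric with the line through a and b. Applied to a zero a in the
    hyperplane of v, the inclusion of the zeros in the two hyperplanes becomes
    the polynomial identity
      g(a,b) b(v) (q(b) a(w) - 2 g(a,b) b(w)) = 0 in b.
    If some a in H is not in the radical of g, then the last factor vanishes
    identically and displays q as a product of two linear forms. Otherwise H
    lies in the radical; since H spans the hyperplane of v, so does the whole
    hyperplane, and q is a multiple of b(v)^2. *)
Lemma quadric_in_hyperplanes (v w : E) (H : set dual) : v != 0 -> w != 0 ->
    (forall a, g a a = 0 -> a v * a w = 0) ->
    (forall a, H a -> g a a = 0 /\ a v = 0) ->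
    (forall x, (forall a, H a -> a x = 0) -> x \in <[v]>%VS) ->
  exists x y, [/\ x != 0, y != 0 &
    forall a b, g a b = 2^-1 * (a x * b y + a y * b x)].
Proof.
move=> v0 w0 gvw Hg Hspan.
have gN0 : ~ (forall a, g a a = 0).
  move=> g0; have := poly_on_lines_eq0 (poly_eval v) (poly_eval w).
  by case=> [a||]; [exact: gvw | exact: eval_neq0 v0 | exact: eval_neq0 w0].
have [[a Ha [b0 gab0]]|Hker] :=
    pselect (exists2 a, H a & exists b, g a b <> 0); last first.
- have gHv (a b : dual) : a v = 0 -> g a b = 0.
    move=> av; have [x xE] := @bidual_eval K E (g^~ b) (g_lin b).
    have /vlineP[k xv] : x \in <[v]>%VS.
      apply: Hspan => c Hc; rewrite -xE; apply: contrapT => gcb.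
      by apply: Hker; exists c => //; exists b.
    by rewrite xE xv linearZ /= av scaler0.
  have [d dv] := functional_neq0 v0.
  have qE (b : dual) : g b b = (g d d / (d v) ^+ 2 * b v) * b v.
    (* r is in the radical, as it vanishes at v *)
    have [r bE rv] : exists2 r, b = (b v / d v) *: d + r & r v = 0.
      exists (- (b v / d v) *: d + b); last by rewrite evalE mulNr mulfVK // addNr.
      by rewrite addrA -scalerDl subrr scale0r add0r.
    rewrite {1 2}bE g_lin !g_linr [g d r]g_sym !(gHv r _ rv).
    by field.
  have c0 : g d d / (d v) ^+ 2 != 0.
    apply/eqP => c0; apply: gN0 => a; by rewrite qE c0 mul0r mul0r.
  exists (g d d / d v ^+ 2 *: v), v; split=> //.
    by rewrite scaler_eq0 negb_or c0.
  by apply: polarization => b; rewrite qE linearZ.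
have [gaa av] := Hg a Ha.
have zero (b : dual) : (g a b * b v) * (g b b * a w - 2 * g a b * b w) = 0.
  (* the trailing 0 puts both summands in the form expected by the linearity
     equations *)
  pose c := g b b *: a + ((- (2 * g a b)) *: b + 0).
  have gcc : g c c = 0.
    have g0l e : g 0 e = 0.
      have := g_lin e 1 0 0; rewrite scale1r addr0 mul1r => /eqP.
      by rewrite -subr_eq0 opprD addNKr oppr_eq0 => /eqP.
    rewrite /c !g_lin !g_linr [g b a]g_sym gaa !g0l ![g _ 0]g_sym !g0l; ring.
  have := gvw c gcc.
  rewrite /c !evalE !zero_lfunE av => h.
  apply: (mulfI (x := 2)); first by rewrite pnatr_eq0.
  by rewrite mulr0 -oppr0 -h; ring.
have := poly_on_lines_eq0 (poly_on_linesM (poly_g a) (poly_eval v)) _ zero.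
case=> [|h|h].
- have := poly_on_linesD (poly_on_linesM poly_q (poly_on_lines_cst (a w)))
    (poly_on_linesM (poly_on_lines_cst (- 2)) (poly_on_linesM (poly_g a) (poly_eval w))).
  move=> h c d; have [p pE] := h c d; exists p => t; rewrite -pE; ring.
- case: (poly_on_lines_eq0 (poly_g a) (poly_eval v) h); last by move/eval_neq0: v0.
  by move=> /(_ b0).
have [x xE] := @bidual_eval K E (g a) (fun k b c => g_linr a k b c).
have x0 : x != 0 by apply/eqP => x0; apply: gab0; rewrite xE x0 linear0.
have aw : a w != 0.
  apply/eqP => aw; have : forall b, g a b * b w = 0.
    move=> c; apply: (mulfI (x := - 2)); first by rewrite oppr_eq0 pnatr_eq0.
    by rewrite mulr0 -[RHS](h c) aw; ring.
  case/(poly_on_lines_eq0 (poly_g a) (poly_eval w)) => [/(_ b0)//|].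
  exact: eval_neq0.
exists ((2 / a w) *: x), w; split=> //.
  by rewrite scaler_eq0 negb_or x0 mulf_neq0 ?invr_eq0 // pnatr_eq0.
apply: polarization => c; rewrite linearZ /= -xE /GRing.scale /=.
by apply: (mulIf aw); have /eqP := h c; rewrite subr_eq0 => /eqP ->; field.
Qed.

End QuadricInHyperplanes.

(** * Smooth curves in a vector space *)

Section SmoothCalculus.
Context {R : realType}.

Lemma Ck_on_cst (E F : normedModType R) k (A : set E) (c : F) :
  Ck_on k A (cst c).
Proof.
elim: k c => [|k IH] c /=; first by move=> x _; exact: cst_continuous.
split=> [x _|v]; first exact: differentiable_cst.
have -> : 'D_v (cst c : E -> F) = cst 0 by apply/funext => x; rewrite derive_cst.
exact: IH.
Qed.

(** The derivative in a fixed direction of an affine map is constant, so all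
    further derivatives vanish. *)
Lemma smooth_on_affine (E F : normedModType R) (A : set E)
    (l : {linear E -> F}) (c : F) :
  continuous l -> smooth_on A (fun x => l x + c).
Proof.
move=> lc.
have dl x : differentiable l x by exact: linear_differentiable.
have df x : differentiable (fun x => l x + c) x.
  by apply: differentiableD => //; exact: differentiable_cst.
have Df x v : 'D_v (fun x => l x + c) x = l v.
  rewrite (@deriveD _ _ _ l (cst c)); last 2 first.
  - exact: diff_derivable.
  - exact: derivable_cst.
  by rewrite derive_cst addr0 deriveE // diff_lin.
case=> [|k] /=.
  by move=> x _; exact: differentiable_continuous.
split=> // v; have -> : 'D_v (fun x => l x + c) = cst (l v) by apply/funext => x; exact: Df.
exact: Ck_on_cst.
Qed.

Lemma Ck_on_comb (E F : normedModType R) k (a : R) (f g : E -> F) :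
  Ck_on k setT f -> Ck_on k setT g -> Ck_on k setT (fun x => a *: f x + g x).
Proof.
elim: k f g => [|k IH] f g /=.
  move=> cf cg x _; apply: cvgD; last exact: cg.
  by apply: cvgZr; exact: cf.
move=> [df Df] [dg Dg]; split=> [x xT|v].
  by apply: differentiableD; [apply: differentiableZ; exact: df | exact: dg].
have -> : 'D_v (fun x => a *: f x + g x) = (fun x => a *: 'D_v f x + 'D_v g x).
  apply/funext => x; rewrite (@deriveD _ _ _ (a *: f) g) ?deriveZ //.
  - by apply: diff_derivable; exact: df.
  - by apply: derivableZ; apply: diff_derivable; exact: df.
  - by apply: diff_derivable; exact: dg.
exact: IH.
Qed.

End SmoothCalculus.

Section Curves.
Context {R : realType} {V : vectType R}.
Implicit Types (c : R -> V) (f : 'Hom(V, R^o)).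

Lemma smooth_curve_comb (a : R) c d :
  smooth_curve c -> smooth_curve d -> smooth_curve (fun t => a *: c t + d t).
Proof.
move=> sc sd f k.
have -> : (fun t => f (a *: c t + d t) : R^o) =
  (fun t => a *: (f (c t) : R^o) + f (d t)).
  by apply/funext => t; rewrite linearP.
by apply: Ck_on_comb; [exact: sc | exact: sd].
Qed.

Lemma smooth_curve_cst (v : V) : smooth_curve (fun=> v).
Proof. by move=> f k; exact: Ck_on_cst. Qed.

Lemma smooth_curve_sum (I : Type) (r : seq I) (a : I -> R) (e : I -> R -> V) :
    (forall i, smooth_curve (e i)) ->
  smooth_curve (fun t => \sum_(i <- r) a i *: e i t).
Proof.
move=> se; elim: r => [|i r IH].
  rewrite (_ : (fun _ => _) = (fun=> 0)); first exact: smooth_curve_cst.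
  by apply/funext => t; rewrite big_nil.
rewrite (_ : (fun _ => _) = (fun t => a i *: e i t + \sum_(j <- r) a j *: e j t)).
  exact: smooth_curve_comb.
by apply/funext => t; rewrite big_cons.
Qed.

Lemma smooth_curve_line (v w : V) (t0 : R) :
  smooth_curve (fun t => v + (t - t0) *: w).
Proof.
have smooth_id : smooth_curve (fun t => t *: w).
  move=> f.
  have -> : (fun t => f (t *: w) : R^o) = (fun t => ( *:%R (f w : R^o) t : R^o) + 0).
    by apply/funext => t; rewrite addr0 linearZ /GRing.scale /= mulrC.
  by apply: (@smooth_on_affine R R R^o setT ( *:%R (f w : R^o))); exact: scaler_continuous.
have -> : (fun t => v + (t - t0) *: w) = (fun t => 1 *: (t *: w) + (v - t0 *: w)).
  by apply/funext => t; rewrite scale1r scalerBl addrCA.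
by apply: smooth_curve_comb => //; exact: smooth_curve_cst.
Qed.

(** The derivative is assembled from the derivatives of the coordinates. *)
Lemma smooth_curve_vderive c t : smooth_curve c -> exists u, vderive c t u.
Proof.
move=> sc; pose e := vbasis {:V}.
pose ec i := linfun (coord e i : V -> R^o).
pose D i := 'D_1 (fun s => ec i (c s) : R^o) t.
exists (\sum_(i < \dim {:V}) D i *: e`_i) => f.
have -> : (fun s => f (c s) : R^o) =
    (\sum_(i < \dim {:V}) f e`_i *: (fun s => ec i (c s) : R^o))%R.
  apply/funext => s; rewrite [in LHS](coord_vbasis (memvf (c s))) linear_sum fct_sumE.
  by apply: eq_bigr => i _; rewrite linearZ /= /ec /GRing.scale /= lfunE mulrC.
rewrite linear_sum; apply: is_derive_eq.
  apply: is_derive_sum => i; apply: is_deriveZ; apply: derivableP.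
  by apply: diff_derivable; have [] := sc (ec i) 1%N => + _; apply.
by apply: eq_bigr => i _; rewrite linearZ /= [LHS]mulrC.
Qed.

End Curves.

(** * Symplectic linear algebra *)

Section SymplecticLinearAlgebra.
Context {R : realType} {V : vectType R}.
Variable omega : {skew_symmetric V}.

Lemma omegaC u v : omega u v = - omega v u.
Proof. by rewrite hermC /= expr1 mulN1r. Qed.

Lemma omegaPr u k v w : omega u (k *: v + w) = k * omega u v + omega u w.
Proof. by rewrite linearDr linearZr. Qed.

Lemma omegaPl u k v w : omega (k *: v + w) u = k * omega v u + omega w u.
Proof. by rewrite omegaC omegaPr opprD -mulrN -!omegaC. Qed.

Lemma omega0r u : omega u 0 = 0.
Proof. by rewrite linear0r. Qed.

Lemma omega0l u : omega 0 u = 0.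
Proof. by rewrite omegaC omega0r oppr0. Qed.

Lemma omegavv u : omega u u = 0.
Proof.
apply: (mulfI (x := 2)); first by rewrite pnatr_eq0.
by rewrite mulr0 mulr_natl mulr2n {1}omegaC addNr.
Qed.

Definition flat (x : V) : 'Hom(V, R^o) := linfun (omega x : V -> R^o).

Lemma flatE x v : flat x v = omega x v.
Proof. by rewrite lfunE. Qed.

Definition flat_on (L : {vspace V}) (x : V) : 'Hom(subvs_of L, R^o) :=
  (flat x \o linfun (@vsval _ _ L))%VF.

Lemma flat_onE L x u : flat_on L x u = omega x (vsval u).
Proof. by rewrite comp_lfunE flatE lfunE. Qed.

Lemma flat_on_linear L : linear (flat_on L).
Proof.
move=> k x y; apply/lfunP => u.
by rewrite add_lfunE scale_lfunE !flat_onE omegaPl.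
Qed.
HB.instance Definition _ L :=
  GRing.isLinear.Build R V 'Hom(subvs_of L, R^o) _ (flat_on L) (@flat_on_linear L).

Hypothesis omega_psymp : is_psymplectic omega.

Lemma omega_nondeg u : (forall v, omega u v = 0) -> u = 0.
Proof.
move=> u0; case: omega_psymp => /eqP rad0 _ _.
by apply/eqP; rewrite -memv0 -rad0; apply/mem_orthovP => v _; exact: u0.
Qed.

(** A functional on the dual of V that separates a given covector from the image
    of flat is the evaluation at a vector, and this vector lies in the radical
    of omega. *)
Lemma flat_surjective (a : 'Hom(V, R^o)) : exists x, forall v, a v = omega x v.
Proof.
have flat_lin : linear flat.
  by move=> k x y; apply/lfunP => u; rewrite add_lfunE scale_lfunE !flatE omegaPl.
pose flatM := GRing.isLinear.Build R V 'Hom(V, R^o) _ flat flat_lin.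
pose flatL : {linear V -> 'Hom(V, R^o)} := HB.pack flat flatM.
have [|aN] := boolP (a \in limg (linfun flatL)).
  move=> /memv_imgP[x _ ->]; exists x => v.
  by rewrite (lfunE flatL) flatE.
have [F [F0 /negP[]]] := separating_functional aN.
have [|y yE] := @bidual_eval R V F; first by move=> k b c; rewrite linearP.
rewrite yE (_ : y = 0) ?linear0 //; apply: omega_nondeg => v.
rewrite omegaC -flatE -yE (F0 (flat v)) ?oppr0 //.
by rewrite -[flat v]/(flatL v) -(lfunE flatL) memv_img ?memvf.
Qed.

Lemma flat_on_surjective (L : {vspace V}) (a : 'Hom(subvs_of L, R^o)) :
  exists x, a = flat_on L x.
Proof.
have [x xE] := flat_surjective (a \o linfun (vsproj L))%VF.
exists x; apply/lfunP => u.
by rewrite flat_onE -xE comp_lfunE lfunE /= vsvalK.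
Qed.

(** The orthogonal of L is the kernel of the surjection of V onto the dual of L,
    so it has dimension 2n - n = n and coincides with L. *)
Lemma lagrangian_maximal (L : {vspace V}) u : lagrangian omega L ->
  (forall w, w \in L -> omega u w = 0) -> u \in L.
Proof.
move=> [isoL dimL] uL.
have memK v : (v \in lker (linfun (flat_on L))) = (flat_on L v == 0).
  by rewrite memv_ker lfunE.
have LK : (L <= lker (linfun (flat_on L)))%VS.
  apply/subvP => v vL; rewrite memK; apply/eqP/lfunP => w.
  by rewrite flat_onE zero_lfunE isoL ?subvsP.
suff /eqP -> : L == lker (linfun (flat_on L)).
  rewrite memK; apply/eqP/lfunP => w.
  by rewrite flat_onE zero_lfunE uL ?subvsP.
rewrite eqEdim LK /=.
have := limg_ker_dim (linfun (flat_on L)) fullv; rewrite capfv -dimL.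
have -> : limg (linfun (flat_on L)) = fullv.
  apply/vspaceP => a; rewrite memvf; have [x ->] := flat_on_surjective a.
  by rewrite -(lfunE (flat_on L)) memv_img ?memvf.
rewrite dim_dual dimvf [X in (_ + X)%N]/(\dim L) mul2n -addnn.
by move=> /addIn ->.
Qed.

(** The vectors that represent a covector of L form a coset of L. If a is
    nonzero, moving y along a vector l of L with a(l) nonzero changes omega x y
    and not the covector b. *)
Lemma orthogonal_primitives (L : {vspace V}) (a b : 'Hom(subvs_of L, R^o)) :
    isotropic omega L ->
  exists x y, [/\ a = flat_on L x, b = flat_on L y & omega x y = 0].
Proof.
move=> isoL; have [y bE] := flat_on_surjective b.
have [a0|/lfunPn[l al]] := eqVneq a 0.
  exists 0, y; split=> //; last exact: omega0l.
  by rewrite a0 linear0.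
have [x aE] := flat_on_surjective a.
rewrite zero_lfunE aE flat_onE in al.
exists x, ((- (omega x y / omega x (vsval l))) *: vsval l + y); split=> //.
  rewrite linearP /= -bE; set c := flat_on L (vsval l).
  suff -> : c = 0 by rewrite scaler0 add0r.
  by apply/lfunP => w; rewrite flat_onE zero_lfunE isoL ?subvsP.
by rewrite omegaPr mulNr mulfVK // addNr.
Qed.

End SymplecticLinearAlgebra.

(** * Velocities of curves of subspaces *)

Section Velocities.
Context {R : realType} {V : vectType R}.
Implicit Types (L : {vspace V}).

Lemma quot_map_section L (q : quot L) : quot_map L (vsval q) = q.
Proof.
have dx : (L^C :&: L = 0)%VS by rewrite capvC capv_compl.
by rewrite /quot_map comp_lfunE lfunE /= (daddv_pi_id dx) ?subvsP // vsvalK.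
Qed.

Lemma quot_map_eq0 L u : (quot_map L u == 0) = (u \in L).
Proof. by rewrite -memv_ker lker_quot_map. Qed.

Lemma quot_map_eq L u v : (quot_map L u == quot_map L v) = (u - v \in L).
Proof. by rewrite -subr_eq0 -linearB quot_map_eq0. Qed.

(** Combine the vectors of a smooth local frame with the constant coefficients
    of v. *)
Lemma smooth_vscurve_through (gamma : R -> {vspace V}) t0 v :
    smooth_vscurve gamma -> v \in gamma t0 ->
  exists c, [/\ smooth_curve c, \forall t \near t0, c t \in gamma t & c t0 = v].
Proof.
move=> sg vg; have [e [se be]] := sg t0.
pose m := \dim (gamma t0); pose X t := [tuple e i t | i < m].
have bX : \forall t \near t0, basis_of (gamma t) (X t) by [].
have Xi t (i : 'I_m) : (X t)`_i = e i t by rewrite -tnth_nth tnth_mktuple.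
exists (fun t => \sum_(i < m) coord (X t0) i v *: e i t); split.
- exact: smooth_curve_sum.
- near=> t; apply: memv_suml => i _; apply: memvZ; rewrite -(Xi t).
  have bXt : basis_of (gamma t) (X t) by near: t.
  by apply: (basis_mem bXt); rewrite mem_nth // size_tuple.
- rewrite [RHS](coord_basis (nbhs_singleton bX) vg).
  by apply: eq_bigr => i _; rewrite Xi.
Unshelve. all: by end_near. Qed.

Lemma velocity_lift L (gamma : R -> {vspace V}) (X : grass_tangent L) (v : subvs_of L) :
    velocity gamma X ->
  exists c u, [/\ \forall t \near (0 : R), c t \in gamma t, c 0 = vsval v,
    vderive c 0 u & (X : 'Hom(_, _)) v = quot_map L u].
Proof.
move=> [sg g0 gX].
have [|c [sc cg c0]] := @smooth_vscurve_through gamma 0 (vsval v) sg.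
  by rewrite g0 subvsP.
have [u cu] := smooth_curve_vderive 0 sc.
by exists c, u; split=> //; rewrite -(gX c u) // c0 vsvalK.
Qed.

End Velocities.

Section UnipotentCurves.
Context {R : realType} {V : vectType R}.
Variable A : 'End(V).
Hypothesis A2 : forall v, A (A v) = 0.

(** For A of square zero the exponential of t A is 1 + t A. *)
Definition unipotent (t : R) : 'End(V) := (\1 + t *: A)%VF.

Lemma unipotentE t v : unipotent t v = v + t *: A v.
Proof. by rewrite add_lfunE id_lfunE scale_lfunE. Qed.

Lemma unipotent0 : unipotent 0 = \1%VF.
Proof. by apply/lfunP => v; rewrite unipotentE scale0r addr0 id_lfunE. Qed.

Lemma unipotentD s t : unipotent (s + t) = (unipotent s \o unipotent t)%VF.
Proof.
apply/lfunP => v; rewrite comp_lfunE !unipotentE linearD linearZ /= A2 scaler0 addr0.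
by rewrite scalerDl -!addrA [t *: _ + _]addrC.
Qed.

Lemma unipotent_inj t : lker (unipotent t) = 0%VS.
Proof.
apply/eqP/lker0P => u v uv.
have h w : unipotent (- t) (unipotent t w) = w.
  by rewrite -comp_lfunE -unipotentD addNr unipotent0 id_lfunE.
by rewrite -(h u) uv h.
Qed.

Lemma dim_unipotent t (L : {vspace V}) : \dim (unipotent t @: L) = \dim L.
Proof. by rewrite limg_dim_eq // unipotent_inj capv0. Qed.

Lemma smooth_unipotent t0 v : smooth_curve (fun t => unipotent (t - t0) v).
Proof.
rewrite (_ : (fun _ => _) = (fun t => v + (t - t0) *: A v)).
  exact: smooth_curve_line.
by apply/funext => t; rewrite unipotentE.
Qed.

Lemma vderive_unipotent v : vderive (fun t => unipotent t v) 0 (A v).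
Proof.
move=> f.
have -> : (fun s => f (unipotent s v) : R^o) =
    cst (f v : R^o) + f (A v) *: (id : R -> R^o).
  by apply/funext => t; rewrite unipotentE linearD linearZ /= [t *: _]mulrC.
apply: is_derive_eq.
by rewrite add0r [LHS]mulr1.
Qed.

(** Near t0 the frame transports a basis of the subspace at time t0, rather than
    one of L: the frame must be indexed by the dimension of that subspace. *)
Lemma smooth_unipotent_vscurve (L : {vspace V}) :
  smooth_vscurve (fun t => (unipotent t @: L)%VS).
Proof.
move=> t0; set W := (_ @: L)%VS.
exists (fun (i : 'I_(\dim W)) t => unipotent (t - t0) (vbasis W)`_i); split.
  by move=> i; exact: smooth_unipotent.
near=> t.
have -> : (unipotent t @: L = unipotent (t - t0) @: W)%VS.
  by rewrite -limg_comp -unipotentD subrK.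
have -> : [seq unipotent (t - t0) (vbasis W)`_(i : 'I_(\dim W)) | i <- enum 'I_(\dim W)] =
    map (unipotent (t - t0)) (vbasis W).
  rewrite -[in RHS](map_tnth_enum (vbasis W)) -[RHS]map_comp; apply: eq_map => i /=.
  by rewrite (tnth_nth 0).
by apply: limg_basis_of; [rewrite unipotent_inj capv0 | exact: vbasisP].
Unshelve. all: by end_near. Qed.

Definition unipotent_velocity (L : {vspace V}) : grass_tangent L :=
  (quot_map L \o A \o linfun (@vsval _ _ L))%VF.

Lemma unipotent_velocityE L v :
  (unipotent_velocity L : 'Hom(_, _)) v = quot_map L (A (vsval v)).
Proof. by rewrite !comp_lfunE (lfunE (@vsval _ _ L)). Qed.

(** If c is a curve in the moving subspace, then c - t A c is its pull-back by
    the flow and stays in L; so its derivative u - A c(0) at 0 is in L. This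
    is read off the functionals that vanish on L. *)
Lemma unipotent_velocityP L :
  velocity (fun t => (unipotent t @: L)%VS) (unipotent_velocity L).
Proof.
split; first exact: smooth_unipotent_vscurve.
  by rewrite unipotent0 lim1g.
move=> c u _ cL cu.
have c0L : c 0 \in L.
  by have := nbhs_singleton cL; rewrite /= unipotent0 lim1g.
rewrite unipotent_velocityE vsprojK //; apply/eqP; rewrite eq_sym quot_map_eq.
apply: contrapT => /negP /separating_functional[f [fL /eqP[]]].
rewrite linearB /=.
pose p : R -> R := fun t => f (c t).
pose q : R -> R := fun t => f (A (c t)).
have dp : is_derive (0 : R) (1 : R) p (f u) := cu f.
have dq : is_derive (0 : R) (1 : R) q (f (A u)).
  by have := cu (f \o A)%VF; under eq_fun do rewrite comp_lfunE; rewrite comp_lfunE.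
have d1 : is_derive (0 : R) (1 : R) (p - id * q) (f u - f (A (c 0))).
  by apply: is_derive_eq; rewrite scale0r add0r [_ *: _]mulr1.
have d2 : is_derive (0 : R) (1 : R) (p - id * q) 0.
  apply: near_eq_is_derive (is_derive_cst _ _ _).
  near=> t; have : c t \in (unipotent t @: L)%VS by near: t.
  move=> /memv_imgP[w wL ctE].
  suff h : f (c t) - t * f (A (c t)) = 0 :> R by apply: esym; exact: h.
  rewrite ctE unipotentE !linearD !linearZ /= A2 !linear0.
  by rewrite fL // addr0 add0r scalerN subrr.
by rewrite -(@derive_val _ _ _ _ _ _ _ d1) (@derive_val _ _ _ _ _ _ _ d2).
Unshelve. all: by end_near. Qed.

End UnipotentCurves.

(** * Tangent vectors to Lagrangian subspaces as bilinear forms *)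

Section TangentForms.
Context {R : realType} {V : vectType R}.
Variables (omega : {skew_symmetric V}) (L : {vspace V}).
Hypotheses (omega_psymp : is_psymplectic omega) (L_lagr : lagrangian omega L).
Implicit Types (X Y : grass_tangent L) (v w : subvs_of L).

(** This is the bilinear form g^Ldot, read off the tangent vector itself instead
    of a one-parameter subgroup that generates it. *)
Definition tangent_pairing X v w : R :=
  omega (vsval ((X : 'Hom(_, _)) v)) (vsval w).

(** L is isotropic, so the pairing does not depend on the representative modulo
    L of the value of X. *)
Lemma tangent_pairing_lift X v w u :
  (X : 'Hom(_, _)) v = quot_map L u -> tangent_pairing X v w = omega u (vsval w).
Proof.
case: L_lagr => isoL _ Xv; rewrite /tangent_pairing.
have : u - vsval ((X : 'Hom(_, _)) v) \in L.
  by rewrite -quot_map_eq quot_map_section Xv.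
move=> /(isoL _ (vsval w))/(_ (subvsP w)).
rewrite -scaleN1r addrC omegaPl mulN1r addrC => /eqP.
by rewrite subr_eq0 => /eqP ->.
Qed.

Lemma tangent_pairingP k X Y v w : tangent_pairing (k *: X + Y) v w =
  k * tangent_pairing X v w + tangent_pairing Y v w.
Proof. by rewrite /tangent_pairing add_lfunE scale_lfunE linearP omegaPl. Qed.

(** A difference of representatives that pairs to zero with L lies in L, by
    maximality of L. *)
Lemma tangent_pairing_inj X Y :
  (forall v w, tangent_pairing X v w = tangent_pairing Y v w) -> X = Y.
Proof.
move=> XY; apply/lfunP => v; rewrite -[LHS]quot_map_section -[RHS]quot_map_section.
apply/eqP; rewrite quot_map_eq; apply: (lagrangian_maximal omega_psymp L_lagr) => w wL.
rewrite addrC -scaleN1r omegaPl mulN1r.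
by have := XY v (vsproj L w); rewrite /tangent_pairing vsprojK // => ->; rewrite addNr.
Qed.

(** The orbit of v under the one-parameter subgroup is an admissible curve in the
    moving subspace. *)
Lemma tangent_form_pairing X g :
  tangent_form omega X g -> forall v w, g v w = tangent_pairing X v w.
Proof.
move=> [phi [dphi [[phi0 _ _ sphi] [_ _ gX] dphiE gE]]] v w; rewrite gE.
rewrite (@tangent_pairing_lift X v w (dphi (vsval v))) //.
rewrite -(gX (fun t => phi t (vsval v)) (dphi (vsval v))) ?phi0 ?id_lfunE ?vsvalK //.
by near=> t; rewrite memv_img ?subvsP.
Unshelve. all: by end_near. Qed.

(** A vector of U is a constant curve in the moving subspace, which gives the
    first equation. A curve through w stays orthogonal to U, because the moving
    subspace is isotropic; the derivative of this relation is the second. *)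
Lemma tangent_pairing_containing (U : {vspace V}) X v w :
    tangent_to (lagr_containing omega U) X -> vsval v \in U ->
  tangent_pairing X v w = 0 /\ tangent_pairing X w v = 0.
Proof.
move=> [gamma gU gX] vU; split.
  have [_ _ gXv] := gX.
  rewrite (@tangent_pairing_lift X v w 0) ?omega0l //.
  rewrite -(gXv (fun=> vsval v) 0) ?vsvalK //; first exact: smooth_curve_cst.
    by near=> t; have [_ /subvP] := gU t; apply.
  by move=> f; rewrite linear0; exact: is_derive_cst.
have [c [u [cg c0 cu Xw]]] := velocity_lift w gX.
rewrite (tangent_pairing_lift v Xw) omegaC -flatE.
have h : is_derive (0 : R) (1 : R) (fun t => flat omega (vsval v) (c t) : R^o) 0.
  apply: near_eq_is_derive (is_derive_cst _ _ _).
  near=> t; rewrite flatE.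
  have [[isog _] /subvP Ug] := gU t.
  by rewrite isog //; [exact: Ug | near: t].
rewrite -(@derive_val _ _ _ _ _ _ _ (cu (flat omega (vsval v)))).
by rewrite (@derive_val _ _ _ _ _ _ _ h) oppr0.
Unshelve. all: by end_near. Qed.

(** Let x and y represent a and b and be orthogonal to each other. The operator
    A v = (omega x v *: y + omega y v *: x) / 2 is in sp(V) and squares to zero,
    so 1 + t A is a one-parameter subgroup of Sp(V), and A pairs vectors of L
    by the symmetric product of a and b. It kills the vectors of L on which
    a and b both vanish, so these stay in all the subspaces of the curve. *)
Lemma symprod_tangent (a b : 'Hom(subvs_of L, R^o)) : exists X,
  [/\ forall v w, tangent_pairing X v w = covector_symprod a b v w,
      tangent_form omega X (covector_symprod a b) &
      forall U : {vspace V}, (U <= L)%VS ->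
        (forall u : subvs_of L, vsval u \in U -> a u = 0 /\ b u = 0) ->
        tangent_to (lagr_containing omega U) X].
Proof.
case: (L_lagr) => isoL dimL.
have [x [y [aE bE xy]]] := orthogonal_primitives omega_psymp a b isoL.
have yx : omega y x = 0 by rewrite omegaC xy oppr0.
pose Af (v : V) := 2^-1 *: (omega x v *: y + omega y v *: x).
have linA : linear Af.
  move=> k u w; rewrite /Af !omegaPr !scalerDl -!scalerA addrACA !scalerDr !scalerA.
  by rewrite !mulrA [2^-1 * k]mulrC.
pose AM := GRing.isLinear.Build R V V _ Af linA.
pose Al : {linear V -> V} := HB.pack Af AM.
pose A : 'End(V) := linfun Al.
have AE (v : V) : A v = 2^-1 *: (omega x v *: y + omega y v *: x) by rewrite lfunE.
have A2 (v : V) : A (A v) = 0.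
  have orthA z : omega z x = 0 -> omega z y = 0 -> omega z (A v) = 0.
    by move=> zx zy; rewrite AE linearZr linearDr !linearZr /= zx zy !mulr0 addr0 mulr0.
  by rewrite AE !orthA ?omegavv // !scale0r addr0 scaler0.
have omegaA (v w : V) :
    omega (A v) w = 2^-1 * (omega x v * omega y w + omega y v * omega x w).
  rewrite AE -[_ *: (_ + _)]addr0 omegaPl omega0l addr0 omegaPl.
  by rewrite -[_ *: x]addr0 omegaPl omega0l addr0.
have skewA (v w : V) : omega v (A w) = - omega (A v) w.
  by rewrite omegaC !omegaA; ring.
have symp t (v w : V) : omega (unipotent A t v) (unipotent A t w) = omega v w.
  rewrite !unipotentE addrC omegaPl ![w + _]addrC !omegaPr.
  rewrite [omega (A v) (A w)]skewA A2 omega0l skewA; ring.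
have lagr t : lagrangian omega (unipotent A t @: L)%VS.
  split; last by rewrite dim_unipotent.
  move=> _ _ /memv_imgP[v vL ->] /memv_imgP[w wL ->].
  by rewrite symp isoL.
have pairing v w : omega (A (vsval v)) (vsval w) = covector_symprod a b v w.
  by rewrite omegaA /covector_symprod aE bE !flat_onE.
exists (unipotent_velocity A L); split.
- move=> v w; rewrite (tangent_pairing_lift w (unipotent_velocityE A v)).
  exact: pairing.
- exists (unipotent A), A; split.
  + split=> //; [exact: unipotent0 | exact: unipotentD |].
    move=> v; have := smooth_unipotent A 0 v.
    by congr smooth_curve; apply/funext => t; rewrite subr0.
  + exact: unipotent_velocityP.
  + exact: vderive_unipotent.
  + by move=> v w; rewrite pairing.
- move=> U UL abU; exists (fun t => (unipotent A t @: L)%VS); last exact: unipotent_velocityP.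
  move=> t; split=> //; apply/subvP => u uU; apply/memv_imgP; exists u.
    exact: subvP UL _ uU.
  have [v uE] := vsval_inP (subvP UL _ uU).
  have := abU v; rewrite -uE => /(_ uU); rewrite aE bE !flat_onE -uE => -[xu yu].
  by rewrite unipotentE AE xu yu !scale0r addr0 !scaler0 addr0.
Qed.

Variable rho : grass_tangent L -> R.
Hypothesis rho_lin : lagr_covector omega rho.

Lemma tangent_containing_lagr (U : {vspace V}) X :
  tangent_to (lagr_containing omega U) X -> lagr_tangent omega X.
Proof. by move=> [gamma gU gX]; exists gamma => // t; have [] := gU t. Qed.

Lemma symprod_lagr_tangent (a b : 'Hom(subvs_of L, R^o)) : exists X,
  [/\ forall v w, tangent_pairing X v w = covector_symprod a b v w,
      tangent_form omega X (covector_symprod a b) & lagr_tangent omega X].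
Proof.
have [X [pX fX tX]] := symprod_tangent a b; exists X; split=> //.
apply: (@tangent_containing_lagr 0%VS); apply: tX; first exact: sub0v.
by move=> u; rewrite memv0 => /eqP u0; have -> : u = 0 by [exact/subvs_inj]; rewrite !linear0.
Qed.

(** The tangent vector chosen in the definition of the form of rho is determined
    by its pairing, so any other one with the same pairing can be used. *)
Lemma covector_formE (a b : 'Hom(subvs_of L, R^o)) X :
    (forall v w, tangent_pairing X v w = covector_symprod a b v w) ->
  covector_form omega rho a b = rho X.
Proof.
move=> pX; rewrite /covector_form; congr rho.
have [Y [pY fY lY]] := symprod_lagr_tangent a b.
set P := [set Z | _].
have [] : P (xget 0 P) by apply: (@xgetPex _ 0 P); exists Y.
move=> _ /tangent_form_pairing h; apply: tangent_pairing_inj => v w.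
by rewrite pX h.
Qed.

Lemma covector_form_sym a b : covector_form omega rho a b = covector_form omega rho b a.
Proof.
have [X [pX _ _]] := symprod_lagr_tangent a b.
rewrite (covector_formE pX); apply/esym/covector_formE => v w.
by rewrite pX /covector_symprod addrC.
Qed.

Lemma covector_form_linear c k a b : covector_form omega rho (k *: a + b) c =
  k * covector_form omega rho a c + covector_form omega rho b c.
Proof.
have [X [pX _ lX]] := symprod_lagr_tangent a c.
have [Y [pY _ lY]] := symprod_lagr_tangent b c.
rewrite (covector_formE pX) (covector_formE pY) -rho_lin //.
apply: covector_formE => v w; rewrite tangent_pairingP pX pY /covector_symprod.
by rewrite !add_lfunE !scale_lfunE /GRing.scale /=; ring.
Qed.

Lemma lagr_tangent0 : lagr_tangent omega (0 : grass_tangent L) /\ rho 0 = 0.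
Proof.
have [X [pX _ lX]] := symprod_lagr_tangent 0 0.
have X0 : X = 0.
  apply: tangent_pairing_inj => v w; rewrite pX /covector_symprod !zero_lfunE.
  by rewrite /tangent_pairing zero_lfunE linear0 omega0l !mul0r addr0 mulr0.
rewrite -X0; split=> //; rewrite X0 in lX *.
have := rho_lin 1 lX lX; rewrite scaler0 addr0 mul1r => /eqP.
by rewrite -subr_eq0 opprD addNKr oppr_eq0 => /eqP.
Qed.

(** The pairing of a vector tangent to the Lagrangian subspaces containing ker a
    vanishes as soon as one argument is in ker a, so it is a multiple of the
    square of a: that tangent space is a line, spanned by the vector X whose
    pairing is this square. *)
Lemma characteristic_kernel (a : 'Hom(subvs_of L, R^o)) : a != 0 ->
  characteristic omega rho (kernel_in a) <-> covector_form omega rho a a = 0.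
Proof.
move=> a0; have [isoL _] := L_lagr.
have [X [pX fX tX]] := symprod_tangent a a.
have tXU : tangent_to (lagr_containing omega (kernel_in a)) X.
  by apply: tX => [|u]; [exact: kernel_in_sub | rewrite mem_kernel_in => /eqP ->].
rewrite (covector_formE pX); split=> [[_ _]|rX]; first exact.
split; [| exact: kernel_in_sub |].
  by move=> u v /(subvP (kernel_in_sub a)) uL /(subvP (kernel_in_sub a)); exact: isoL.
move=> Y tY.
have /lfunPn[z] := a0; rewrite zero_lfunE => az.
pose k := tangent_pairing Y z z / (a z * a z).
have pl c v w u : tangent_pairing Y (c *: v + w) u =
    c * tangent_pairing Y v u + tangent_pairing Y w u.
  by rewrite /tangent_pairing !linearP /= omegaPl.
have pr c v w u : tangent_pairing Y u (c *: v + w) =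
    c * tangent_pairing Y u v + tangent_pairing Y u w.
  by rewrite /tangent_pairing -omegaPr.
have split_z v : exists2 r, v = (a v / a z) *: z + r & vsval r \in kernel_in a.
  exists (v - (a v / a z) *: z); first by rewrite addrC subrK.
  by rewrite mem_kernel_in linearB linearZ /= /GRing.scale /= mulfVK // subrr.
have YE : Y = k *: X + 0.
  apply: tangent_pairing_inj => v w; rewrite tangent_pairingP pX.
  rewrite {2}/tangent_pairing zero_lfunE linear0 omega0l addr0.
  have [r vE rU] := split_z v; have [s wE sU] := split_z w.
  rewrite {1}vE {1}wE pl !pr.
  have r0 u := (tangent_pairing_containing u tY rU).1.
  have s0 u := (tangent_pairing_containing u tY sU).2.
  rewrite !r0 !s0 /covector_symprod /k.
  by field.
have [l0 rho0] := lagr_tangent0.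
rewrite YE rho_lin //; last exact: tangent_containing_lagr tXU.
by rewrite rX rho0 mulr0 addr0.
Qed.

End TangentForms.

(** * Pencils of hyperplanes as submanifolds *)

Section AffineHyperplanes.
Context {R : realType}.

Lemma mulmxr_continuous m n (M : 'M[R]_(m, n)) :
  continuous (mulmxr M : 'rV[R]_m -> 'rV[R]_n).
Proof.
move=> x; apply: differentiable_continuous.
have -> : (mulmxr M : 'rV[R]_m -> 'rV[R]_n) =
    \sum_(j < m) (fun y : 'rV[R]_m => y 0 j *: row j M).
  by apply/funext => y; rewrite fct_sumE /= mulmx_sum_row.
apply: differentiable_sum => j; apply: differentiableZl.
exact: differentiable_coord.
Qed.

(** The invertible factor on the left of c in Gaussian elimination sends y to a
    row whose entry 0 is proportional to y *m c; the transposition moves this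
    entry to the end, where slice charts of codimension one expect it. *)
Lemma straighten_column m (c : 'cV[R]_m.+1) : c != 0 ->
  exists2 M : 'M[R]_m.+1, M \in unitmx &
    forall y : 'rV_m.+1, ((y *m c) 0 0 == 0) = ((y *m M) 0 ord_max == 0).
Proof.
move=> c0; have rk1 : \rank c = 1%N.
  by apply/eqP; rewrite eqn_leq rank_leq_col lt0n mxrank_eq0.
exists (col_ebase c *m tperm_mx 0 ord_max).
  by rewrite unitmx_mul col_ebase_unit unitmx_perm.
move=> y; rewrite mulmxA -[c in LHS]mulmx_ebase rk1 !mulmxA.
rewrite -xcolE; move: (y *m col_ebase c) => z.
rewrite [in RHS]mxE tpermR.
have -> : z *m pid_mx 1 = (z 0 0)%:M :> 'M[R]_1.
  apply/matrixP => i j; rewrite !ord1 !mxE eqxx mulr1n (bigD1 0) //= !mxE /= mulr1.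
  rewrite big1 ?addr0 // => k k0; rewrite !mxE.
  have -> : (k == 0%N :> nat) = false by exact: negPf k0.
  by rewrite mulr0.
rewrite mul_scalar_mx mxE mulf_eq0; have := row_ebase_unit c.
by rewrite unitmxE det_mx11 unitfE => /negPf ->; rewrite orbF.
Qed.

(** One global affine chart straightens the hyperplane. When c = 0 the set is
    empty: this happens for the hyperplanes through v in a chart with X_0
    proportional to v, whose domain avoids them all. *)
Lemma submanifold_affine_hyperplane m (b : R) (c : 'cV[R]_m) :
    b != 0 \/ c != 0 ->
  submanifold m.-1 [set x : 'rV[R]_m | b + (x *m c) 0 0 = 0].
Proof.
have [-> [b0|/eqP//]|c0 _] := eqVneq c 0.
  by move=> p /=; rewrite mulmx0 mxE addr0 => b0'; rewrite b0' eqxx in b0.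
case: m c c0 => [c|m c c0 p /= Sp].
  by rewrite flatmx0 eqxx.
have [M Mu Mc] := straighten_column c0.
exists setT, setT, (fun x => mulmxr M x + - (p *m M)),
  (fun y => mulmxr (invmx M) y + p); split=> //.
  split; [exact: openT | exact: openT | | |].
  - exact/smooth_on_affine/mulmxr_continuous.
  - exact/smooth_on_affine/mulmxr_continuous.
  - split=> // x _ /=.
    + by rewrite -mulmxBl mulmxK // subrK.
    + by rewrite mulmxDl mulmxKV // addrK.
move=> x _; have -> : b + (x *m c) 0 0 = ((x - p) *m c) 0 0.
  have mxB (y z : 'M[R]_1) : (y - z) 0 0 = y 0 0 - z 0 0 by rewrite !mxE.
  rewrite mulmxBl mxB addrC; congr (_ + _).
  by apply/eqP; rewrite -addr_eq0 Sp.
split=> [/eqP|h].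
  rewrite Mc /= mulmxBl => /eqP h i mi.
  suff -> : i = ord_max by [].
  by apply/val_inj/eqP; rewrite eqn_leq mi -ltnS ltn_ord.
by apply/eqP; rewrite Mc mulmxBl; apply/eqP/h.
Qed.

End AffineHyperplanes.

Section HyperplanesThrough.
Context {R : realType} {V : vectType R} (L : {vspace V}).

Definition hyperplanes_through (v : V) : set {vspace V} :=
  [set U | hyperplanes L U /\ v \in U].

Section Chart.
Context (m : nat) (X : m.+1.-tuple V) (x : 'rV[R]_m).
Hypothesis bX : basis_of L X.

(** Modulo the generators of the hyperplane with coordinates x, the vector
    X_(j+1) equals x_j X_0. *)
Lemma chart_decomposition v : v \in L ->
  v = (coord X ord0 v + \sum_(j < m) x 0 j * coord X (lift ord0 j) v) *: tnth X ord0
    + \sum_(j < m) coord X (lift ord0 j) v *: (tnth X (lift ord0 j) - x 0 j *: tnth X ord0).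
Proof.
move=> vL; rewrite [LHS](coord_basis bX vL) big_ord_recl -tnth_nth.
rewrite scalerDl scaler_suml -addrA -big_split /=; congr (_ + _).
apply: eq_bigr => j _; rewrite scalerBr scalerA [x 0 j * _]mulrC addrC subrK.
by rewrite (tnth_nth 0).
Qed.

Lemma chart_generator j :
  tnth X (lift ord0 j) - x 0 j *: tnth X ord0 \in hyperplane_chart_inv X x.
Proof. by apply/memv_span/mapP; exists j; rewrite ?mem_enum. Qed.

(** In coordinates, the hyperplane with coordinates x is the kernel of the
    covector with entries (1, x_0, ..., x_(m-1)). *)
Lemma mem_chart v : v \in L -> (v \in hyperplane_chart_inv X x) =
  (coord X ord0 v + \sum_(j < m) x 0 j * coord X (lift ord0 j) v == 0).
Proof.
move=> vL; apply/idP/eqP => [vU|v0]; last first.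
  rewrite (chart_decomposition vL) v0 scale0r add0r.
  by apply: memv_suml => j _; apply/memvZ/chart_generator.
pose f : 'Hom(V, R^o) := linfun (coord X ord0 : V -> R^o) +
  \sum_(j < m) x 0 j *: linfun (coord X (lift ord0 j) : V -> R^o).
have fE w : f w = coord X ord0 w + \sum_(j < m) x 0 j * coord X (lift ord0 j) w.
  rewrite add_lfunE lfunE sum_lfunE; congr (_ + _).
  by apply: eq_bigr => j _; rewrite scale_lfunE lfunE.
rewrite -fE; apply/eqP; rewrite -memv_ker; apply: subvP vU.
have fX := basis_free bX.
have coordX i k : coord X k (tnth X i) = (i == k)%:R.
  by rewrite (tnth_nth 0) coord_free.
have f0 : f (tnth X ord0) = 1.
  by rewrite fE coordX eqxx big1 ?addr0 // => k _; rewrite coordX mulr0.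
have fj j : f (tnth X (lift ord0 j)) = x 0 j.
  rewrite fE coordX add0r (bigD1 j) //= coordX eqxx mulr1 big1 ?addr0 // => k kj.
  by rewrite coordX (inj_eq lift_inj) eq_sym (negPf kj) mulr0.
apply/span_subvP => _ /mapP[j _ ->].
by rewrite memv_ker linearB linearZ /= f0 fj /GRing.scale /= mulr1 subrr.
Qed.

Lemma hyperplanes_chart : hyperplanes L (hyperplane_chart_inv X x).
Proof.
have XL i : tnth X i \in L by apply: (basis_mem bX); rewrite mem_tnth.
have UL : (hyperplane_chart_inv X x <= L)%VS.
  by apply/span_subvP => _ /mapP[j _ ->]; rewrite memvB ?memvZ.
have dimL : \dim L = m.+1 by exact: size_basis bX.
split=> //; apply/eqP; rewrite eqn_leq; apply/andP; split.
  rewrite dimL ltnS (leq_trans (dim_span _)) // size_map.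
  by rewrite -cardE card_ord.
have LU : (L <= <[tnth X ord0]> + hyperplane_chart_inv X x)%VS.
  apply/subvP => v vL; rewrite (chart_decomposition vL) memv_add ?memvZ ?memv_line //.
  by apply: memv_suml => j _; apply/memvZ/chart_generator.
rewrite (leq_trans (dimvS LU)) // (leq_trans (dimv_add_leqif _ _)) // dim_vline.
by rewrite -[X in (_ <= X)%N]add1n leq_add2r leq_b1.
Qed.

End Chart.

(** In a chart, containing v is one nontrivial affine equation. *)
Lemma hyperplane_family_through v : v \in L -> v != 0 ->
  hyperplane_family L (\dim L).-2 (hyperplanes_through v).
Proof.
move=> vL v0; split=> [U []//|X bX].
set m := (\dim L).-1 in X bX *.
pose c := \col_(j < m) coord X (lift ord0 j) v.
rewrite (_ : [set x | _] = [set x : 'rV[R]_m | coord X ord0 v + (x *m c) 0 0 = 0]).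
  apply: submanifold_affine_hyperplane.
  have [b0|] := eqVneq (coord X ord0 v) 0; [right | by left].
  apply: contra v0 => /eqP/matrixP c0.
  rewrite (coord_basis bX vL) big_ord_recl b0 scale0r add0r big1 // => j _.
  by have := c0 j 0; rewrite !mxE => ->; rewrite scale0r.
have cE x : (x *m c) 0 0 = \sum_(j < m) x 0 j * coord X (lift ord0 j) v.
  by rewrite mxE; apply: eq_bigr => j _; rewrite mxE.
apply/seteqP; split=> x /=; rewrite cE.
  by move=> [_]; rewrite (mem_chart x bX vL) => /eqP.
by move=> /eqP; rewrite -(mem_chart x bX vL); split=> //; exact: hyperplanes_chart.
Qed.

(** A vector outside the line of v is avoided by the kernel of a covector that
    vanishes at v and not at that vector. *)
Lemma dim_bigcap_through v : v \in L -> v != 0 ->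
  dim_bigcap L (hyperplanes_through v) 1.
Proof.
move=> vL v0; exists <[v]>%VS; last by rewrite dim_vline v0.
move=> u; split=> [/vlineP[k ->]|[uL hu]].
  by split=> [|U [_ vU]]; rewrite memvZ.
apply: contrapT => /negP uv.
have [z zE] := vsval_inP uL; have [w wE] := vsval_inP vL.
have zw : z \notin <[w]>%VS.
  by apply: contra uv => /vlineP[k zk]; rewrite zE wE zk memvZ ?memv_line.
have [a [aw az]] := separating_functional zw.
have a0 : a != 0 by apply/lfunPn; exists z; rewrite zero_lfunE.
case/negP: az; rewrite -mem_kernel_in -zE; apply: hu.
split; first by split; [exact: kernel_in_sub | exact: dim_kernel_in].
by rewrite wE mem_kernel_in aw ?memv_line.
Qed.

End HyperplanesThrough.

(** * Decomposable covectors *)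

Lemma dim_bigcap1_line (R : realType) (V : vectType R) (L : {vspace V})
    (H : set {vspace V}) : dim_bigcap L H 1 ->
  exists v : subvs_of L, [/\ v != 0, forall U, H U -> vsval v \in U &
    forall z : subvs_of L, (forall U, H U -> vsval z \in U) -> z \in <[v]>%VS].
Proof.
move=> [W WE dW]; have x0 : vpick W != 0 by rewrite vpick0 -dimv_eq0 dW.
have xW : vpick W \in W by exact: memv_pick.
have [xL xH] := (WE _).1 xW; have [v vE] := vsval_inP xL.
exists v; split=> [|U|z zH].
- by apply: contra x0 => /eqP v0; rewrite vE v0 linear0.
- by rewrite -vE; exact: xH.
have Wx : W = <[vpick W]>%VS.
  by apply/esym/eqP; rewrite eqEdim dW dim_vline x0 andbT -memvE.
have : vsval z \in W by apply/WE; split; [exact: subvsP | exact: zH].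
rewrite Wx vE => /vlineP[k zk]; apply/vlineP; exists k.
exact/subvs_inj.
Qed.

Unset Implicit Arguments.

Theorem theorem3p9 (R : realType) (V : vectType R) (omega : {skew_symmetric V})
    (n : nat) (L : {vspace V}) (rho : grass_tangent L -> R) :
  (2 <= n)%N -> \dim {:V} = (2 * n)%N -> is_psymplectic omega ->
  lagrangian omega L -> lagr_covector omega rho ->
  decomposable omega rho <->
  exists H H' : set {vspace V},
    [/\ hyperplane_family L (n - 2) H, hyperplane_family L (n - 2) H',
        [set U | characteristic omega rho U /\ \dim U = (n - 1)%N] = H `|` H',
        dim_bigcap L H 1 & dim_bigcap L H' 1].
Proof.
move=> n2 dimV omega_psymp L_lagr rho_lin.
have dimL : \dim L = n.
  by case: L_lagr => _; rewrite dimV => /eqP; rewrite eqn_mul2l => /eqP.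
have dimP (U : {vspace V}) : (\dim U = (n - 1)%N) <-> ((\dim U).+1 = \dim L).
  by rewrite dimL subn1; split=> [->|<-//]; rewrite prednK // ltnW.
have charE (a : 'Hom(subvs_of L, R^o)) : a != 0 ->
    characteristic omega rho (kernel_in a) <-> covector_form omega rho a a = 0.
  exact: characteristic_kernel.
have k2 : (n - 2)%N = (\dim L).-2 by rewrite dimL subn2.
split=> [[v [w [v0 w0 form_vw]]]|[H [H' [famH famH' charHH' capH capH']]]].
- have vs0 (u : subvs_of L) : u != 0 -> vsval u != 0.
    by apply: contra => /eqP u0; apply/eqP/subvs_inj; rewrite u0 linear0.
  have charvw (a : 'Hom(subvs_of L, R^o)) : a != 0 ->
      characteristic omega rho (kernel_in a) <->
      vsval v \in kernel_in a \/ vsval w \in kernel_in a.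
    move=> a0; rewrite charE // form_vw /vector_symprod !mem_kernel_in.
    have -> : 2^-1 * (a v * a w + a w * a v) = a v * a w :> R by field.
    by split=> [/eqP|h]; [rewrite mulf_eq0 => /orP | apply/eqP; rewrite mulf_eq0; apply/orP].
  have famP (u : subvs_of L) : u != 0 ->
      hyperplane_family L (n - 2) (hyperplanes_through L (vsval u)).
    by rewrite k2 => /vs0; apply: hyperplane_family_through; exact: subvsP.
  have capP (u : subvs_of L) : u != 0 ->
      dim_bigcap L (hyperplanes_through L (vsval u)) 1.
    by move=> /vs0; apply: dim_bigcap_through; exact: subvsP.
  exists (hyperplanes_through L (vsval v)), (hyperplanes_through L (vsval w)).
  split; [exact: famP | exact: famP | | exact: capP | exact: capP].
  apply/seteqP; split=> U /=.
    move=> [cU /dimP dU]; have [_ UL _] := cU.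
    have [a a0 UE] := hyperplane_kernel UL dU.
    by rewrite UE in cU; have /charvw[] := cU; rewrite -?UE // => h; [left | right].
  by case=> -[[UL dU] zU]; split; try exact/dimP;
    have [a a0 UE] := hyperplane_kernel UL dU; rewrite UE charvw // -UE; [left | right].
- have [v [v0 vH vspan]] := dim_bigcap1_line capH.
  have [w [w0 wH' _]] := dim_bigcap1_line capH'.
  have [|||v1 [w1 [v10 w10 form_vw]]] := @quadric_in_hyperplanes R (subvs_of L)
    (covector_form omega rho) (covector_form_sym omega_psymp L_lagr rho)
    (covector_form_linear omega_psymp L_lagr rho_lin) v w
    [set a | a != 0 /\ H (kernel_in a)] v0 w0.
  + move=> a qa; have [->|a0] := eqVneq a 0; first by rewrite zero_lfunE mul0r.
    have : (H `|` H') (kernel_in a).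
      rewrite -charHH' /=; split; first exact/charE.
      by apply/dimP; exact: dim_kernel_in.
    by case=> [/vH|/wH'] h; apply/eqP; rewrite mulf_eq0 -!mem_kernel_in h ?orbT.
  + move=> a [a0 Ha]; split; last by apply/eqP; rewrite -mem_kernel_in vH.
    apply/charE => //.
    have : (H `|` H') (kernel_in a) by left.
    by rewrite -charHH' => -[].
  + move=> z hz; apply: vspan => U HU; have [UL dU] := famH.1 _ HU.
    have [a a0 UE] := hyperplane_kernel UL dU.
    by rewrite UE mem_kernel_in hz //; split=> //; rewrite -UE.
  + by exists v1, w1; split.
Qed.
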